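(* There exists an $\mathcal{O}(n)$ time algorithm that, using $\log n$ bits, generates in-place of the inverse $\pi^-$ of $\pi\in IP(n)$, where $\varphi^-$ is defined implicitly, the multiset $m\in M(n)$ associated with $\pi$ (as a linearly ordered sequence).
   Context: $[n]=\{1,\ldots,n\}$. $M(n)$ is the set of all multisets of $n$ elements selected with replacement from $[n]$; every multiset is regarded as linearly ordered, i.e. as a nondecreasing sequence $m(1),\ldots,m(n)$. An idempotent permutation of degree $k$ ($1\le k\le n$) is a permutation $\pi$ of $[n]$ together with a distinguished set of indices $A=\{a_1<\cdots<a_k\}\subseteq[n]$ such that the values $c_i=\pi(a_i)$ satisfy $1=c_1<c_2<\cdots<c_k$; put $c_{k+1}=n+1$ and $c'_i=c_{i+1}-c_i$. $IP(n)$ denotes the set of idempotent permutations of all degrees $1\le k\le n$. The multiset associated with $\pi$ is $m=\{c'_1\cdot a_1,\ldots,c'_k\cdot a_k\}$, where $c'_i$ is the multiplicity of $a_i$; as a sequence, $m(j)=a_i$ for $c_i\le j<c_{i+1}$. $\pi^-$ is the inverse permutation. Its characteristic function $\varphi^-(x)=1$ if $x\in\{c_1,\ldots,c_k\}$ and $0$ otherwise is ''defined implicitly'' when $\pi^-$ is stored in an array $D[1\ldots n]$ with $D_{c_i}=-a_i$ and $D_x=\pi^-(x)$ for all other $x$. ''In-place'' means that at termination the same array holds $m$. Computation is on a unit-cost random access machine; ''$\log n$ bits'' means that besides the array one auxiliary variable of $\log n$ bits (an index or value of magnitude $O(n)$) is used. *)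

(* Defs.v *)
From mathcomp Require Import all_boot all_order all_fingroup all_algebra.

Set Implicit Arguments.
Unset Strict Implicit.
Unset Printing Implicit Defensive.

Import Order.TTheory GRing.Theory Num.Theory.

Local Open Scope ring_scope.

(** * Idempotent permutations and multisets *)

(* [n] = {1, ..., n} is represented by 'I_n: the ordinal i stands for i.+1.
   [enum A] lists a set A : {set 'I_n} in increasing order, so [dist_idx A] is
   a_1 < ... < a_k and [dist_val pi A] is c_1, ..., c_k with c_i = pi(a_i). *)
Definition dist_idx n (A : {set 'I_n}) : seq nat :=
  [seq (val i).+1 | i <- enum A].

Definition dist_val n (pi : {perm 'I_n}) (A : {set 'I_n}) : seq nat :=
  [seq (val (pi i)).+1 | i <- enum A].

Definition idempotent_perm n (k : nat) (pi : {perm 'I_n}) (A : {set 'I_n}) :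
    Prop :=
  [/\ (1 <= k <= n)%N,
      #|A| = k,
      nth 0%N (dist_val pi A) 0 = 1%N
    & sorted ltn (dist_val pi A)].

Definition in_M (n : nat) (m : seq nat) : Prop :=
  [/\ size m = n, all (fun x => (1 <= x <= n)%N) m & sorted leq m].

(* c'_i = c_(i+1) - c_i; the default value of nth provides c_(k+1) = n + 1. *)
Definition dist_mult n (pi : {perm 'I_n}) (A : {set 'I_n}) (i : nat) : nat :=
  (nth n.+1 (dist_val pi A) i.+1 - nth n.+1 (dist_val pi A) i)%N.

Definition assoc_multiset n (pi : {perm 'I_n}) (A : {set 'I_n}) : seq nat :=
  flatten [seq nseq (dist_mult pi A i) (nth 0%N (dist_idx A) i)
          | i <- iota 0 #|A|].

Definition phi_inv n (pi : {perm 'I_n}) (A : {set 'I_n}) (x : 'I_n) : bool :=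
  (val x).+1 \in dist_val pi A.

(* The array D[1..n] holding pi^- with phi^- encoded in the signs. Since
   pi^-(c_i) = a_i, the entry at c_i is -a_i. *)
Definition implicit_inverse n (pi : {perm 'I_n}) (A : {set 'I_n}) : seq int :=
  [seq (let v := ((val ((pi^-1)%g x)).+1)%:Z in
        if phi_inv pi A x then - v else v)
  | x <- enum 'I_n].

(** * A unit-cost random access machine with one array and one register *)

(* The whole memory is the array D[1..n] and a single register x. The length n
   can be read but not changed. The only arithmetic is one addition or
   subtraction per instruction, whose result goes directly to memory, so there
   is no hidden intermediate storage. *)

Inductive location : Type :=
| Reg                     (* x *)
| Cell of int.            (* Cell d is D[x + d] *)

Inductive operand : Type :=
| Const of int
| Len                     (* n *)
| Loc of location.

Inductive instruction : Type :=
| Plus of location & operand & operand     (* loc := u + v *)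
| Minus of location & operand & operand    (* loc := u - v *)
| JumpLe of operand & operand & nat.       (* if u <= v then goto l *)

Definition program := seq instruction.

Record state : Type := State { pc : nat; reg : int; arr : seq int }.

(* Array addresses run from 1 to n; any other access is a fault (None). *)
Definition valid_addr (D : seq int) (z : int) : bool :=
  (1 <= z) && (z <= (size D)%:Z).

Definition read (s : state) (l : location) : option int :=
  match l with
  | Reg => Some (reg s)
  | Cell d => let z := reg s + d in
      if valid_addr (arr s) z then Some (nth 0 (arr s) `|z|%N.-1) else None
  end.

Definition eval (s : state) (u : operand) : option int :=
  match u with
  | Const c => Some c
  | Len => Some (size (arr s))%:Z
  | Loc l => read s l
  end.

Definition write (s : state) (l : location) (v : int) : option state :=
  match l with
  | Reg => Some (State (pc s).+1 v (arr s))
  | Cell d => let z := reg s + d in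
      if valid_addr (arr s) z
      then Some (State (pc s).+1 (reg s) (set_nth 0 (arr s) `|z|%N.-1 v))
      else None
  end.

Definition exec (s : state) (ins : instruction) : option state :=
  match ins with
  | Plus l u v =>
      if (eval s u, eval s v) is (Some a, Some b) then write s l (a + b)
      else None
  | Minus l u v =>
      if (eval s u, eval s v) is (Some a, Some b) then write s l (a - b)
      else None
  | JumpLe u v lbl =>
      if (eval s u, eval s v) is (Some a, Some b) then
        Some (State (if a <= b then lbl else (pc s).+1) (reg s) (arr s))
      else None
  end.

Definition step (p : program) (s : state) : option state :=
  if onth p (pc s) is Some ins then exec s ins else None.

Definition run (p : program) (t : nat) (s : state) : option state :=
  iter t (obind (step p)) (Some s).

Definition halted (p : program) (s : state) : bool := (size p <= pc s)%N.

Definition init (D : seq int) : state := State 0 0 D.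

(* The register has magnitude at most b * n, i.e. log n + O(1) bits. The cells
   stay within -n..n, the range of the signed input, so that no additional
   information can be packed into the array. *)
Definition fits (b : nat) (s : state) : bool :=
  (`|reg s| <= (b * size (arr s))%:Z) &&
  all (fun v : int => `|v| <= (size (arr s))%:Z) (arr s).

(* Started on D, p halts after at most c * n unit-cost steps with E in the
   same array, and every state on the way satisfies [fits b]. *)
Definition computes_in_place (p : program) (c b : nat) (D E : seq int) : Prop :=
  exists (t : nat) (s : state),
    [/\ (t <= c * size D)%N,
        run p t (init D) = Some s,
        halted p s,
        arr s = E
      & forall (i : nat) (s' : state),
          (i <= t)%N -> run p i (init D) = Some s' -> fits b s'].

(* Main.v *)
(* The array D of the inverse satisfies D[c_i] = -a_i, and D[x] > 0 at all other
   x. Since m is constant on [c_i, c_(i+1)) with value a_i, a single scan from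
   left to right suffices: a negative entry is negated, and a positive entry is
   overwritten by its left neighbour, which already holds its final value. The
   scan never meets a positive entry at x = 1 because c_1 = 1. *)
Require Import Defs.
From mathcomp Require Import all_boot all_order all_fingroup all_algebra.
From mathcomp Require Import zify.

Set Implicit Arguments.
Unset Strict Implicit.
Unset Printing Implicit Defensive.

Import Order.TTheory GRing.Theory Num.Theory.

Local Open Scope nat_scope.

(** * The multiset as a step function *)

(** The associated multiset for arbitrary lists, so that induction can peel off the first stair; the
    default [N] of [nth] acts as the sentinel c_(k+1). *)
Definition stairs (N : nat) (c a : seq nat) : seq nat :=
  flatten [seq nseq (nth N c i.+1 - nth N c i) (nth 0 a i)
          | i <- iota 0 (size c)].

Lemma stairs_cons N c0 c a0 a :
  stairs N (c0 :: c) (a0 :: a) = nseq (head N c - c0) a0 ++ stairs N c a.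
Proof.
rewrite /stairs /= nth0 -[1]/(1 + 0) iotaDl -map_comp; congr (_ ++ flatten _).
Qed.

Lemma sorted_head_le c N y :
  sorted ltn (rcons c N) -> y \in rcons c N -> head N c <= y.
Proof.
case: c => [_|c0 c /= pc]; first by rewrite inE => /eqP->.
rewrite in_cons => /predU1P[-> //|yc].
exact: ltnW (allP (order_path_min ltn_trans pc) y yc).
Qed.

Lemma path_head c0 c N :
  path ltn c0 (rcons c N) -> [/\ c0 < head N c & sorted ltn (rcons c N)].
Proof. by case: c => [|c1 c] /= => [/andP[]|/andP[]]. Qed.

Lemma head_mem N c : head N c < N -> head N c \in c.
Proof. by case: c => [|c0 c] /=; rewrite ?ltnn // mem_head. Qed.

(** The widths of the stairs telescope. *)
Lemma size_stairs N c a :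
  size a = size c -> sorted ltn (rcons c N) ->
  size (stairs N c a) = N - head N c.
Proof.
elim: c a => [|c0 c IHc] [|a0 a] //=; first by rewrite subnn.
move=> [sac] /path_head[c0c sc].
have hN : head N c <= N by apply: (sorted_head_le sc); rewrite mem_rcons mem_head.
by rewrite stairs_cons size_cat size_nseq IHc //; lia.
Qed.

(** Position [j] stands for the value [head N c + j], and a new stair begins exactly at the members
    of [c]. The bound on [j] forces [c] to be nonempty, so [j = 0] always takes the first branch. *)
Lemma nth_stairs N c a j :
  size a = size c -> sorted ltn (rcons c N) -> j < N - head N c ->
  nth 0 (stairs N c a) j =
    if head N c + j \in c then nth 0 a (index (head N c + j) c)
    else nth 0 (stairs N c a) j.-1.
Proof.
elim: c a j => [|c0 c IHc] [|a0 a] j //=; first by rewrite subnn.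
move=> [sac] /path_head[c0c sc] jN.
set d := head N c - c0; rewrite stairs_cons !nth_cat size_nseq !nth_nseq.
rewrite inE -/d; case: (posnP j) => [->|j_gt0].
  by rewrite addn0 eqxx subn_gt0 c0c.
have -> /= : (c0 + j == c0) = false by lia.
have -> /= : (c0 == c0 + j) = false by lia.
case: ltnP => [jd|dj].
  have -> : (c0 + j \in c) = false.
    apply/negP => jc; have := sorted_head_le sc (y := c0 + j).
    by rewrite mem_rcons inE jc orbT => /(_ isT); lia.
  by have -> : j.-1 < d by lia.
have cj : c0 + j = head N c + (j - d) by lia.
rewrite IHc // -?cj; last by lia.
case: ifP => // jc; case: (ltngtP j d) => [|dj'|jd]; first by lia.
  by have [-> ->] : (j.-1 < d) = false /\ (j - d).-1 = j.-1 - d by lia.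
(* At [j = d] a new stair starts: the value is the head of [c], against [jc]. *)
by move: jc; rewrite cj jd subnn addn0 head_mem //; lia.
Qed.

Lemma mem_stairs N c a x :
  size a = size c -> x \in stairs N c a -> x \in a.
Proof.
move=> sac /flattenP[s /mapP[i]]; rewrite mem_iota => /= ic ->.
by rewrite mem_nseq => /andP[_ /eqP->]; rewrite mem_nth // sac.
Qed.

(** Pairwise comparison splits over concatenation; later entries all come from [a], whose members
    are at least [a0]. *)
Lemma sorted_stairs N c a :
  size a = size c -> sorted leq a -> sorted leq (stairs N c a).
Proof.
rewrite !(sorted_pairwise leq_trans).
elim: c a => [|c0 c IHc] [|a0 a] //= [sac] /andP[a0a sa].
rewrite stairs_cons pairwise_cat IHc // andbT; apply/andP; split.
  apply/allrelP => x y; rewrite mem_nseq => /andP[_ /eqP->] /(mem_stairs sac).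
  exact/allP.
by elim: (_ - _) => //= m ->; rewrite all_nseq leqnn orbT.
Qed.

Lemma sorted_dist_idx n (A : {set 'I_n}) : sorted ltn (dist_idx A).
Proof.
rewrite sorted_map /enum_mem; apply: sorted_filter.
  by move=> y x z /=; apply: ltn_trans.
have := iota_ltn_sorted 0 n; rewrite -val_enum_ord sorted_map enumT.
done.
Qed.

(** * The scan *)

Local Open Scope ring_scope.

(** Bundling the run with the memory bound on all its states lets both be composed segment by
    segment. *)
Definition fit_run p b t s s' :=
  run p t s = Some s' /\
  forall i s'', (i <= t)%N -> run p i s = Some s'' -> fits b s''.

Lemma run_step p t s s1 :
  step p s = Some s1 -> run p t.+1 s = run p t s1.
Proof. by move=> e; rewrite /run iterSr /= e. Qed.

Lemma run_add p t u s s1 :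
  run p t s = Some s1 -> run p (t + u)%N s = run p u s1.
Proof. by move=> e; rewrite addnC /run iterD -/(run p t s) e. Qed.

Lemma fit_run0 p b s : fits b s -> fit_run p b 0 s s.
Proof. by move=> fs; split=> // [[|//]] s'' _ [<-]. Qed.

Lemma fit_run_step p b t s s1 s' :
  fits b s -> step p s = Some s1 -> fit_run p b t s1 s' ->
  fit_run p b t.+1 s s'.
Proof.
move=> fs e [rs fr]; split; first by rewrite (run_step _ e).
move=> [|i] s'' it; first by case=> <-.
by rewrite (run_step _ e); apply: fr.
Qed.

Lemma fit_run_trans p b t u s s1 s' :
  fit_run p b t s s1 -> fit_run p b u s1 s' -> fit_run p b (t + u) s s'.
Proof.
move=> [r1 f1] [r2 f2]; split; first by rewrite (run_add _ r1).
move=> i s'' itu; have [it|ti] := leqP i t; first exact: f1.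
rewrite -(subnKC (ltnW ti)) (run_add _ r1); apply: f2.
by rewrite leq_subLR.
Qed.

(** Addresses start at 1 but [nth] counts from 0, hence the shift to [k.+1]. *)
Lemma read_cell q x D d k :
  x + d = k.+1%:Z -> (k < size D)%N ->
  read (State q x D) (Cell d) = Some (nth 0 D k).
Proof. by move=> /= -> kD; rewrite /valid_addr /= lez_nat kD. Qed.

Lemma write_cell q x D d k v :
  x + d = k.+1%:Z -> (k < size D)%N ->
  write (State q x D) (Cell d) v = Some (State q.+1 x (set_nth 0 D k v)).
Proof. by move=> /= -> kD; rewrite /valid_addr /= lez_nat kD. Qed.

(** Instruction 0 advances the register and 1 tests the sign; 2 and 3 copy the left neighbour and
    skip 4, which negates; 5 exits to 7, past the end, once the register reaches n; 6 loops back. *)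
Definition scan : program :=
  [:: Plus Reg (Loc Reg) (Const 1);
      JumpLe (Loc (Cell 0)) (Const 0) 4;
      Plus (Cell 0) (Loc (Cell (-1))) (Const 0);
      JumpLe (Const 0) (Const 0) 5;
      Minus (Cell 0) (Const 0) (Loc (Cell 0));
      JumpLe Len (Loc Reg) 7;
      JumpLe (Const 0) (Const 0) 0].

(** The loop invariant: the array once its first [i] cells are final. *)
Definition scanned (D E : seq int) (i : nat) : seq int := take i E ++ drop i D.

Section Scan.

Variables D E : seq int.
Hypothesis sizeDE : size D = size E.
Hypothesis D_le : all (fun v : int => `|v| <= (size D)%:Z) D.
Hypothesis E_le : all (fun v : int => `|v| <= (size D)%:Z) E.
(** All that the loop needs to know about the multiset. The conjunct [0 < i] keeps the read of the
    left neighbour from faulting. *)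
Hypothesis scanP : forall i, (i < size D)%N ->
  if nth 0 D i <= 0 then nth 0 E i = - nth 0 D i
  else (0 < i)%N /\ nth 0 E i = nth 0 E i.-1.

Lemma size_scanned i : size (scanned D E i) = size D.
Proof. by rewrite size_cat size_take_min size_drop -sizeDE; lia. Qed.

Lemma nth_scanned i j :
  nth 0 (scanned D E i) j = nth 0 (if (j < i)%N then E else D) j.
Proof.
rewrite nth_cat size_take_min -sizeDE nth_drop.
have [jD|Dj] := ltnP j (size D).
  have -> : (j < minn i (size D))%N = (j < i)%N by lia.
  by case: ltnP => ji; [rewrite nth_take | congr (nth _ _ _); lia].
(* Past the end both sides are the default 0, so [j] carries no bound. *)
rewrite ifN; last by lia.
have jS : (size D <= i + (j - minn i (size D)))%N by lia.
by rewrite (nth_default _ jS) nth_default //; case: ifP; rewrite -?sizeDE.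
Qed.

Lemma set_nth_scanned i : (i < size D)%N ->
  set_nth 0 (scanned D E i) i (nth 0 E i) = scanned D E i.+1.
Proof.
move=> iD; apply: (@eq_from_nth _ 0).
  by rewrite size_set_nth !size_scanned; apply/maxn_idPr.
move=> j _; rewrite nth_set_nth /= !nth_scanned.
by rewrite ltnS [(j <= i)%N]leq_eqVlt; case: eqVneq => [->|].
Qed.

Lemma fits_scanned i q x :
  (x <= size D)%N -> fits 1 (State q x%:Z (scanned D E i)).
Proof.
move=> xD; rewrite /fits /= mul1n size_scanned lez_nat xD /= all_cat.
apply/andP; split; apply/allP => v.
  by move/mem_take/(allP E_le).
by move/mem_drop/(allP D_le).
Qed.

(** The longest path, for a positive entry, runs instructions 0 to 3 and then 5 and 6, which gives
    the constant 6. *)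
Lemma fit_run_iteration i : (i < size D)%N ->
  exists2 t, (t <= 6)%N &
    fit_run scan 1 t (State 0 i%:Z (scanned D E i))
      (State (if (i.+1 < size D)%N then 0 else 7) i.+1%:Z (scanned D E i.+1)).
Proof.
move=> iD; have iD' := ltnW iD.
have sS : (i < size (scanned D E i))%N by rewrite size_scanned.
have x0 : i.+1%:Z + 0 = i.+1%:Z by rewrite addr0.
(* Both branches meet at instruction 5, so the end test is treated once. *)
have tailP : exists2 t, (t <= 2)%N & fit_run scan 1 t
  (State 5 i.+1%:Z (scanned D E i.+1))
  (State (if (i.+1 < size D)%N then 0 else 7) i.+1%:Z (scanned D E i.+1)).
  case: (ltnP i.+1 (size D)) => iD1.
    exists 2%N => //; apply: fit_run_step; first exact: fits_scanned.
      by rewrite /step /= size_scanned lez_nat leqNgt iD1.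
    apply: fit_run_step; [exact: fits_scanned | by [] |].
    exact/fit_run0/fits_scanned.
  exists 1%N => //; apply: fit_run_step; first exact: fits_scanned.
    by rewrite /step /= size_scanned lez_nat iD1.
  exact/fit_run0/fits_scanned.
case: tailP => t t2 tailP.
have := scanP iD; case: ifP => Di.
  move=> Ei; exists t.+3; first by lia.
  apply: fit_run_step; [exact: fits_scanned | by rewrite /step /= -PoszD addn1 |].
  apply: fit_run_step; [exact: fits_scanned | |].
    rewrite /step /exec [onth _ _]/= /eval (read_cell 1 x0 sS).
    by rewrite nth_scanned ltnn Di.
  apply: fit_run_step; [exact: fits_scanned | | exact: tailP].
  rewrite /step /exec [onth _ _]/= /eval (read_cell 4 x0 sS).
  by rewrite nth_scanned ltnn sub0r -Ei (write_cell _ _ x0 sS) set_nth_scanned.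
move=> [i_gt0 Ei]; exists t.+4; first by lia.
have x1 : i.+1%:Z + (-1) = i.-1.+1%:Z by lia.
have sS1 : (i.-1 < size (scanned D E i))%N by lia.
apply: fit_run_step; [exact: fits_scanned | by rewrite /step /= -PoszD addn1 |].
apply: fit_run_step; [exact: fits_scanned | |].
  rewrite /step /exec [onth _ _]/= /eval (read_cell 1 x0 sS).
  by rewrite nth_scanned ltnn Di.
apply: fit_run_step; [exact: fits_scanned | |].
  rewrite /step /exec [onth _ _]/= /eval (read_cell 2 x1 sS1).
  (* The cell at [i.-1] is already final, so the copied value comes from [E]. *)
  rewrite nth_scanned prednK // leqnn addr0 -Ei (write_cell _ _ x0 sS).
  by rewrite set_nth_scanned.
by apply: fit_run_step; [exact: fits_scanned | | exact: tailP].
Qed.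

(** The end test follows the loop body, so on an empty array the first read would fault. *)
Lemma scan_correct : (0 < size D)%N -> computes_in_place scan 6 1 D E.
Proof.
move=> D_gt0.
have [t t6 [rt ft]] : exists2 t, (t <= 6 * size D)%N &
  fit_run scan 1 t (init D) (State 7 (size D)%:Z E).
  have loop i : (i <= size D)%N -> exists2 t, (t <= 6 * i)%N &
    fit_run scan 1 t (init D)
      (State (if (i < size D)%N then 0 else 7) i%:Z (scanned D E i)).
    elim: i => [_|i IHi iD].
      rewrite D_gt0 /scanned take0 drop0 /=; exists 0%N => //.
      have := fits_scanned 0 0 (leq0n _); rewrite /scanned take0 drop0.
      exact: fit_run0.
    have [t t6 ft] := IHi (ltnW iD); rewrite iD in ft.
    have [u u6 fu] := fit_run_iteration iD.
    by exists (t + u)%N; [lia | exact: fit_run_trans ft fu].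
  have [t t6] := loop _ (leqnn _); rewrite ltnn /scanned drop_size cats0.
  have -> : take (size D) E = E by rewrite sizeDE take_size.
  by exists t.
by exists t, (State 7 (size D)%:Z E).
Qed.

End Scan.

(** * Idempotent permutations *)

Section IdempotentPerm.

Variables (n : nat) (pi : {perm 'I_n}) (A : {set 'I_n}).

Let pos (i : 'I_n) : nat := (val (pi i)).+1.

Lemma assoc_multiset_stairs :
  assoc_multiset pi A = stairs n.+1 (dist_val pi A) (dist_idx A).
Proof. by rewrite /assoc_multiset /stairs size_map -cardE. Qed.

(** Write [x] as pi(i) with i = pi^-1(x): by injectivity, its index in [dist_val pi A] is that of i
    in [enum A]. *)
Lemma index_dist_val (x : 'I_n) : phi_inv pi A x ->
  nth 0%N (dist_idx A) (index (val x).+1 (dist_val pi A)) =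
    (val ((pi^-1)%g x)).+1.
Proof.
have pos_inj : injective pos by move=> y z [] /val_inj /perm_inj.
rewrite /phi_inv; move: (permKV pi x); move: ((pi^-1)%g x) => i <-.
rewrite -/(pos i) -[dist_val _ _]/(map pos (enum A)) mem_map // index_map // => iA.
by rewrite (nth_map i) ?index_mem // nth_index.
Qed.

Variable k : nat.
Hypothesis ip : idempotent_perm k pi A.

Let size_dist : size (dist_idx A) = size (dist_val pi A).
Proof. by rewrite !size_map. Qed.

Let sorted_dist_val : sorted ltn (rcons (dist_val pi A) n.+1).
Proof.
case: ip => _ _ _ sc; rewrite (sorted_pairwise ltn_trans) pairwise_rcons.
rewrite -(sorted_pairwise ltn_trans) sc andbT.
by apply/allP => _ /mapP[i _ ->]; rewrite ltnS ltn_ord.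
Qed.

Let head_dist_val : head n.+1 (dist_val pi A) = 1%N.
Proof. by case: ip => _ _ + _; case: dist_val. Qed.

Lemma size_assoc_multiset : size (assoc_multiset pi A) = n.
Proof.
by rewrite assoc_multiset_stairs size_stairs // head_dist_val subSS subn0.
Qed.

Lemma assoc_multiset_le : all (fun x => 1 <= x <= n)%N (assoc_multiset pi A).
Proof.
rewrite assoc_multiset_stairs; apply/allP => x /(mem_stairs size_dist).
by case/mapP => i _ ->; rewrite /= ltn_ord.
Qed.

Lemma assoc_multiset_in_M : in_M n (assoc_multiset pi A).
Proof.
split; [exact: size_assoc_multiset | exact: assoc_multiset_le |].
rewrite assoc_multiset_stairs sorted_stairs //.
by apply: sub_sorted (sorted_dist_idx A) => x y; apply: ltnW.
Qed.

(** Since c_1 = 1, the 0-based position [x] stands for the value [x + 1], and membership in the list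
    of the c_i becomes [phi_inv]. *)
Lemma nth_assoc_multiset (x : 'I_n) :
  nth 0%N (assoc_multiset pi A) x =
    if phi_inv pi A x then (val ((pi^-1)%g x)).+1
    else nth 0%N (assoc_multiset pi A) x.-1.
Proof.
rewrite assoc_multiset_stairs nth_stairs // head_dist_val ?subSS ?subn0 //.
by rewrite add1n -/(phi_inv pi A x); case: ifP => // /index_dist_val.
Qed.

Lemma phi_inv0 (x : 'I_n) : val x = 0%N -> phi_inv pi A x.
Proof.
case: ip => _ _ + _; rewrite /phi_inv => + ->.
by case: dist_val => //= ? ? ->; rewrite mem_head.
Qed.

Lemma size_implicit_inverse : size (implicit_inverse pi A) = n.
Proof. by rewrite size_map size_enum_ord. Qed.

Lemma nth_implicit_inverse (x : 'I_n) :
  nth 0 (implicit_inverse pi A) x =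
    let v := ((val ((pi^-1)%g x)).+1)%:Z in if phi_inv pi A x then - v else v.
Proof. by rewrite (nth_map x) ?size_enum_ord // nth_ord_enum. Qed.

Lemma scan_assoc_multiset :
  computes_in_place scan 6 1 (implicit_inverse pi A)
    (map Posz (assoc_multiset pi A)).
Proof.
apply: scan_correct; rewrite ?size_implicit_inverse.
- by rewrite size_map size_assoc_multiset.
- apply/allP => _ /mapP[x _ ->] /=.
  by case: ifP => _; rewrite ?normrN lez_nat ltn_ord.
- rewrite all_map; apply: sub_all assoc_multiset_le => v /= /andP[_ vn].
  by rewrite lez_nat.
- move=> i ni; have [x ->] : exists x : 'I_n, i = x by exists (Ordinal ni).
  rewrite !(nth_map 0%N) ?size_assoc_multiset ?(leq_ltn_trans (leq_pred x)) //.
  rewrite nth_implicit_inverse [nth 0%N _ x]nth_assoc_multiset.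
  (* Inverse values are at least 1, so the sign of an entry decides [phi_inv]; a positive entry at
     position 0 is excluded by [phi_inv0]. *)
  rewrite /=; case fx: (phi_inv pi A x); rewrite ?oppr_le0 /= ?opprK //.
  by split=> //; case: posnP => // /phi_inv0; rewrite fx.
- by case: ip => /andP[k1 kn] _ _ _; apply: leq_trans kn.
Qed.

End IdempotentPerm.

Theorem theorem3p10 :
  exists (p : program) (c b : nat),
  forall (n k : nat) (pi : {perm 'I_n}) (A : {set 'I_n}),
    idempotent_perm k pi A ->
    in_M n (assoc_multiset pi A) /\
    computes_in_place p c b (implicit_inverse pi A)
      (map Posz (assoc_multiset pi A)).
Proof.
exists scan, 6%N, 1%N => n k pi A ip.
split; [exact: assoc_multiset_in_M ip | exact: scan_assoc_multiset ip].
Qed.
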